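(* Let $t\ge 2$ be an integer. Let $g(t)$ denote the maximum chromatic number of a graph that does not contain $K_t$ as a minor, and let $h(t)$ denote the largest chromatic number of a hypergraph that does not contain $K_t$ as a minor. Then every hypergraph $H$ that does not contain $K_t$ as a minor is $2g(t)$-colorable, i.e. $\chi(H)\le 2g(t)$. Equivalently, $h(t)$ is well-defined (finite) and $h(t)\le 2g(t)$.
   Context: A hypergraph is a pair $H=(V,E)$ with $V=V(H)$ a finite set and $E=E(H)$ a set of subsets of $V$ (hyperedges), each of size at least $2$. Graphs are the hypergraphs all of whose hyperedges have size exactly $2$; $K_t$ is the complete graph on $t$ vertices. Subhypergraph: $H_1\subseteq H_2$ if $V(H_1)\subseteq V(H_2)$ and $E(H_1)\subseteq E(H_2)$. Contraction: for $e\in E(H)$ and a new vertex $v\notin V(H)$, let $\phi:V(H)\to (V(H)\setminus e)\cup\{v\}$ be the identity on $V(H)\setminus e$ and constantly $v$ on $e$. Then $H/e$ has vertex-set $(V(H)\setminus e)\cup\{v\}$ and hyperedge-set $\{\phi(f)\mid f\in E(H),\ f\not\subseteq e\}$. Minor: $H_2$ is a minor of $H_1$ if a hypergraph isomorphic to $H_2$ can be obtained from $H_1$ by a finite sequence of operations, each being either moving to a subhypergraph or contracting a hyperedge. For graphs this is the usual notion of graph minor. Coloring: a set of vertices is independent in $H$ if it contains no hyperedge as a subset. A proper coloring of $H$ is a map $c:V(H)\to S$ all of whose color classes are independent (no hyperedge is monochromatic); $\chi(H)$ is the minimum size of a color set $S$ admitting a proper coloring, and $H$ is $k$-colorable if $\chi(H)\le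 k$. The finiteness of $g(t)$ for every $t$ is a known fact. *)

(* Defs.v *)
From HB Require Import structures.
From mathcomp Require Import all_boot.

Set Implicit Arguments.
Unset Strict Implicit.
Unset Printing Implicit Defensive.

Record hypergraph := Hypergraph {
  hvertex : finType;
  hedges : {set {set hvertex}};
  hedges_ge2 : [forall e : {set hvertex} in hedges, 2 <= #|e|] }.

Definition is_graph (H : hypergraph) : bool :=
  [forall e : {set hvertex H} in hedges H, #|e| == 2].

Definition complete_edges (t : nat) : {set {set 'I_t}} :=
  [set e : {set 'I_t} | #|e| == 2].

Lemma complete_edges_ge2 (t : nat) :
  [forall e : {set 'I_t} in complete_edges t, 2 <= #|e|].
Proof. by apply/forall_inP => e; rewrite inE => /eqP ->. Qed.

Definition complete_graph (t : nat) : hypergraph :=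
  Hypergraph (complete_edges_ge2 t).

Definition isomorphic (H1 H2 : hypergraph) : Prop :=
  exists2 f : hvertex H1 -> hvertex H2, bijective f &
    forall e : {set hvertex H1}, (f @: e \in hedges H2) = (e \in hedges H1).

(* The subhypergraph with vertex set W and hyperedge set F; it is only used
   when F is a set of hyperedges of H contained in W. *)
Section Subhypergraph.
Variables (H : hypergraph) (W : {set hvertex H}) (F : {set {set hvertex H}}).

Definition sub_edges : {set {set {x : hvertex H | x \in W}}} :=
  [set e : {set {x : hvertex H | x \in W}} | val @: e \in F :&: hedges H].

Lemma sub_edges_ge2 :
  [forall e : {set {x : hvertex H | x \in W}} in sub_edges, 2 <= #|e|].
Proof.
apply/forall_inP => e; rewrite !inE => /andP[_ eH].
by move/forall_inP: (hedges_ge2 H) => /(_ _ eH); rewrite card_imset //; apply: val_inj.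
Qed.

Definition subhypergraph : hypergraph := Hypergraph sub_edges_ge2.

End Subhypergraph.

(* The contraction H / e. Its vertex type is (V \ e) plus a new vertex None:
   insub sends x to Some x if x is not in e, and to None if x is in e. *)
Section Contraction.
Variables (H : hypergraph) (e : {set hvertex H}).

Definition contract_map (x : hvertex H) : option {x : hvertex H | x \notin e} :=
  insub x.

Definition contract_edges : {set {set option {x : hvertex H | x \notin e}}} :=
  [set contract_map @: f | f : {set hvertex H} in hedges H & ~~ (f \subset e)].

Lemma contract_edges_ge2 :
  [forall f : {set option {x : hvertex H | x \notin e}} in contract_edges, 2 <= #|f|].
Proof.
apply/forall_inP => _ /imsetP[f + ->].
rewrite inE => /andP[fH /subsetPn[x xf xe]].
move/forall_inP: (hedges_ge2 H) => /(_ _ fH).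
rewrite (cardsD1 x) xf ltnS => /card_gt0P[y]; rewrite !inE => /andP[yx yf].
have neq : contract_map x != contract_map y.
  rewrite /contract_map (insubT (fun z => z \notin e) xe).
  case: insubP => [u _ uy|//]; apply: contra_neq yx => -[xu].
  by rewrite -uy -xu.
suff <- : #|[set contract_map x; contract_map y]| = 2.
  by apply/subset_leq_card/subsetP => z; rewrite !inE => /orP[]/eqP ->; apply: imset_f.
by rewrite cards2 neq.
Qed.

Definition contraction : hypergraph := Hypergraph contract_edges_ge2.

End Contraction.

Inductive obtainable (H : hypergraph) : hypergraph -> Prop :=
| obtainable_refl : obtainable H H
| obtainable_sub (H' : hypergraph) (W : {set hvertex H'})
    (F : {set {set hvertex H'}}) :
    obtainable H H' -> F \subset hedges H' -> (forall f, f \in F -> f \subset W) ->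
    obtainable H (subhypergraph W F)
| obtainable_contract (H' : hypergraph) (e : {set hvertex H'}) :
    obtainable H H' -> e \in hedges H' ->
    obtainable H (contraction e).

Definition is_minor (H2 H1 : hypergraph) : Prop :=
  exists2 H : hypergraph, obtainable H1 H & isomorphic H H2.

Definition independent (H : hypergraph) (A : {set hvertex H}) : bool :=
  [forall e : {set hvertex H} in hedges H, ~~ (e \subset A)].

Definition proper_coloring (H : hypergraph) (S : finType)
    (c : {ffun hvertex H -> S}) : bool :=
  [forall s, independent [set x | c x == s]].

Definition has_coloring (H : hypergraph) (k : nat) : bool :=
  [exists c : {ffun hvertex H -> 'I_k}, proper_coloring c].

Lemma has_coloring_ex (H : hypergraph) : exists k, has_coloring H k.
Proof.
exists #|hvertex H|; apply/existsP; exists [ffun x => enum_rank x].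
apply/forallP => s; apply/forall_inP => e eH; apply/negP => /subsetP es.
move/forall_inP: (hedges_ge2 H) => /(_ _ eH); apply/negP; rewrite -leqNgt.
apply/card_le1_eqP => x y /es + /es; rewrite !inE !ffunE => /eqP <- /eqP.
by move/enum_rank_inj.
Qed.

Definition chromatic_number (H : hypergraph) : nat := ex_minn (has_coloring_ex H).

Definition colorable (k : nat) (H : hypergraph) : Prop := chromatic_number H <= k.

Definition max_chromatic_number (P : hypergraph -> Prop) (m : nat) : Prop :=
  (exists2 H, P H & chromatic_number H = m) /\
  (forall H, P H -> chromatic_number H <= m).

Definition is_g (t g : nat) : Prop :=
  max_chromatic_number
    (fun G => is_graph G /\ ~ is_minor (complete_graph t) G) g.

Definition is_h (t h : nat) : Prop :=
  max_chromatic_number (fun H => ~ is_minor (complete_graph t) H) h.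

(* Main.v *)
From Stdlib Require Classical_Prop.
Require Import Defs.
From mathcomp Require Import all_boot.

Set Implicit Arguments.
Unset Strict Implicit.
Unset Printing Implicit Defensive.

(** The heart of the matter is that every hypergraph H has a graph minor G with
    chi(H) <= 2 chi(G) ([chromatic_number_quotient]).  Split the vertex set
    greedily: let X_1 be a maximal set of vertices whose induced hypergraph is
    connected and 2-colourable, X_2 a maximal such set among the remaining
    vertices, and so on.  Contracting every part to a point and keeping only
    the hyperedges whose image has two elements yields G.  Colour a vertex by
    the pair formed of its colour in a 2-colouring of its part and of the colour
    of its part in an optimal colouring of G.  Only inclusion-minimal
    hyperedges e have to be checked.  If e lies in one part, the 2-colouring
    deals with it.  Otherwise let X be the first part that e meets.  Among the
    minimal hyperedges contained in X union e that meet X and are not contained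
    in X, one has a single vertex z outside X: as long as there are two vertices
    outside, the maximality of X yields a hyperedge with fewer of them
    ([attaching_hedge]).  That hyperedge makes X adjacent in G to the part of z,
    and z belongs to e, so e receives two different colours.

    If H has no K_t minor, neither has G, so chi(H) <= 2 g(t).  It remains to
    know that g(t) exists, i.e. that graphs without a K_t minor have bounded
    chromatic number.  This is the classical breadth-first search argument
    ([layered_coloring], [clique_model_or_coloring]): each layer after
    the starting vertex is attached to a connected set, so it has no K_(t-1)
    minor, and alternating two palettes between consecutive layers gives
    2^(t-1) colours by induction.

    Minors are handled through models: a partial map phi from the vertices of
    H1 to those of H2 with connected fibres, such that every hyperedge of H2
    is the image of a hyperedge of H1.  Models compose, and a model exists
    exactly when H2 is a minor of H1 ([minor_has_model], [model_minor]). *)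

(** * Connected sets of vertices *)

Definition cuts (T : finType) (A B : {set T}) : bool :=
  (B :&: A != set0) && ~~ (B \subset A).

Lemma cutsP (T : finType) (A B : {set T}) :
  reflect (exists x y, [/\ x \in B, x \in A, y \in B & y \notin A]) (cuts A B).
Proof.
apply: (iffP andP) => [[/set0Pn[x /setIP[xB xA]] /subsetPn[y yB yA]]|].
  by exists x, y.
move=> [x [y [xB xA yB yA]]]; split; first by apply/set0Pn; exists x; rewrite inE xB.
by apply/subsetPn; exists y.
Qed.

Section Connectivity.
Variable H : hypergraph.
Implicit Types A B C e : {set hvertex H}.

(** Connectedness is expressed through cuts rather than through paths: preimages
    and images of connected sets are then dealt with by transporting the cut. *)
Definition connected B : bool :=
  (B != set0) &&
  [forall A, cuts A B ==> [exists e in hedges H, (e \subset B) && cuts A e]].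

Lemma connectedP B :
  reflect (B != set0 /\ forall A, cuts A B ->
             exists e, [/\ e \in hedges H, e \subset B & cuts A e])
          (connected B).
Proof.
apply: (iffP andP) => -[B0 cB]; split=> //.
  by move=> A /(implyP (forallP cB A))/exists_inP[e eH /andP[]]; exists e.
apply/forallP=> A; apply/implyP=> /cB[e [eH eB eA]].
by apply/exists_inP; exists e; rewrite ?eB.
Qed.

Lemma connected1 x : connected [set x].
Proof.
apply/connectedP; split=> [|A /cutsP[y [z []]]].
  by apply/set0Pn; exists x; rewrite inE.
by rewrite !inE => /eqP-> xA /eqP->; rewrite xA.
Qed.

Lemma hedge_gt1 e : e \in hedges H -> 1 < #|e|.
Proof. by move/forall_inP: (hedges_ge2 H); apply. Qed.

Lemma hedge_neq0 e : e \in hedges H -> e != set0.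
Proof. by move/hedge_gt1; rewrite -card_gt0; apply: ltn_trans. Qed.

Lemma connected_hedge e : e \in hedges H -> connected e.
Proof.
by move=> eH; apply/connectedP; split=> [|A Ae]; [apply: hedge_neq0 | exists e].
Qed.

(** If A cuts C without cutting B, then B lies on one side of A, and the
    hyperedge joining B to a point of C on the other side crosses the cut. *)
Lemma connected_absorb B C : connected B -> B \subset C ->
    {in C :\: B, forall y,
       exists e, [/\ e \in hedges H, e \subset C, y \in e & e :&: B != set0]} ->
  connected C.
Proof.
move=> /connectedP[B0 cB] BC att; apply/connectedP; split=> [|A].
  by case/set0Pn: B0 => x /(subsetP BC) xC; apply/set0Pn; exists x.
case/cutsP=> x [y [xC xA yC yA]].
have [/cB[e [eH eB eA]]|] := boolP (cuts A B).
  by exists e; split=> //; apply: subset_trans BC.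
rewrite negb_and !negbK => /orP[/eqP BA0|BA].
  have xB : x \notin B by apply/negP=> xB; have := in_set0 x; rewrite -BA0 inE xB xA.
  have [|e [eH eC xe /set0Pn[z /setIP[ze zB]]]] := att x; first by rewrite inE xB.
  exists e; split=> //; apply/cutsP; exists x, z; split=> //.
  by apply/negP=> zA; have := in_set0 z; rewrite -BA0 inE zB zA.
have yB : y \notin B by apply: contra yA; apply: (subsetP BA).
have [|e [eH eC ye /set0Pn[z /setIP[ze zB]]]] := att y; first by rewrite inE yB.
by exists e; split=> //; apply/cutsP; exists z, y; split=> //; apply: (subsetP BA).
Qed.

End Connectivity.

(** * Minor models *)

Definition fiber (T U : finType) (phi : T -> option U) (y : U) : {set T} :=
  [set x | phi x == Some y].

(** The fibres of phi are the branch sets, and [None] collects the vertices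
    deleted from H1.  A hyperedge of H1 that realises one of H2 must avoid the
    deleted vertices, hence the equality of images in the option type. *)
Definition minor_model (H1 H2 : hypergraph) (phi : hvertex H1 -> option (hvertex H2)) :=
  (forall y, connected (fiber phi y)) /\
  forall e2 : {set hvertex H2}, e2 \in hedges H2 ->
    exists2 e1, e1 \in hedges H1 & phi @: e1 = Some @: e2.

Lemma fiber_inhabited (H1 H2 : hypergraph) (phi : hvertex H1 -> option (hvertex H2)) :
  minor_model phi -> forall y, exists x, phi x = Some y.
Proof.
move=> [con _] y; case/connectedP: (con y) => /set0Pn[x].
by rewrite inE => /eqP; exists x.
Qed.

Lemma imset_Some_mem (T U : finType) (phi : T -> option U) (e : {set T}) (f : {set U}) x :
  phi @: e = Some @: f -> x \in e -> exists2 y, y \in f & phi x = Some y.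
Proof.
move=> ef xe; have /imsetP[y yf ->] : phi x \in Some @: f by rewrite -ef imset_f.
by exists y.
Qed.

Lemma imset_Some_lift (T U : finType) (phi : T -> option U) (e : {set T}) (f : {set U}) y :
  phi @: e = Some @: f -> y \in f -> exists2 x, x \in e & phi x = Some y.
Proof.
move=> ef yf; have /imsetP[x xe ->] : Some y \in phi @: e by rewrite ef imset_f.
by exists x.
Qed.

(** This is what makes models compose: a branch set of the composite is the
    union of the branch sets over a connected set. *)
Lemma connected_preimset (H1 H2 : hypergraph) (phi : hvertex H1 -> option (hvertex H2))
    (B : {set hvertex H2}) :
  minor_model phi -> connected B -> connected [set x | phi x \in Some @: B].
Proof.
move=> Mphi /connectedP[B0 cB]; have [con lift_e] := Mphi.
set C := [set x | _].
have fibC y : y \in B -> fiber phi y \subset C.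
  by move=> yB; apply/subsetP=> x; rewrite !inE => /eqP->; rewrite imset_f.
apply/connectedP; split=> [|A].
  case/set0Pn: B0 => y yB; have [x phix] := fiber_inhabited Mphi y.
  by apply/set0Pn; exists x; rewrite inE phix imset_f.
case/cutsP=> x [x' [+ xA + x'A]]; rewrite !inE => /imsetP[y yB phix] /imsetP[y' y'B phix'].
(* Either A separates two points of one fibre, or it is a union of fibres. *)
have [/exists_inP[z zB Az]|] := boolP [exists z in B, cuts A (fiber phi z)].
  have /connectedP[_ cz] := con z.
  have [e [eH ez eA]] := cz A Az; exists e; split=> //.
  by apply: subset_trans (fibC _ zB).
rewrite negb_exists_in => /forall_inP unsplit.
have same u v z : z \in B -> phi u = Some z -> phi v = Some z -> u \in A -> v \in A.
  move=> zB pu pv uA; apply/negPn/negP=> vA; case/negP: (unsplit z zB).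
  by apply/cutsP; exists u, v; rewrite !inE pu pv.
pose A' := [set z | [exists u in A, phi u == Some z]].
have [|e2 [e2H e2B /cutsP[z [z' [ze2 zA' z'e2 z'A']]]]] := cB A'.
  apply/cutsP; exists y, y'; split=> //.
    by rewrite inE; apply/exists_inP; exists x; rewrite ?phix.
  rewrite inE; apply/exists_inP=> -[u uA /eqP pu].
  by case/negP: x'A; apply: (same u x' y').
have [e1 e1H e12] := lift_e _ e2H.
exists e1; split=> //.
  apply/subsetP=> u /(imset_Some_mem e12)[w we2 pu].
  by rewrite inE pu imset_f // (subsetP e2B).
have [u ue pu] := imset_Some_lift e12 ze2; have [v ve pv] := imset_Some_lift e12 z'e2.
apply/cutsP; exists u, v; split=> //.
  move: zA'; rewrite inE => /exists_inP[w wA /eqP pw].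
  by apply: (same w u z) => //; apply: (subsetP e2B).
by apply: contra z'A' => vA; rewrite inE; apply/exists_inP; exists v; rewrite ?pv.
Qed.

Lemma minor_model_comp (H1 H2 H3 : hypergraph)
    (phi : hvertex H1 -> option (hvertex H2)) (psi : hvertex H2 -> option (hvertex H3)) :
  minor_model phi -> minor_model psi -> minor_model (pcomp psi phi).
Proof.
move=> Mphi [con lift3]; have [_ lift2] := Mphi; split=> [y|e3 /lift3[e2 e2H e23]].
  suff -> : fiber (pcomp psi phi) y = [set x | phi x \in Some @: fiber psi y].
    exact: connected_preimset.
  apply/setP=> x; rewrite !inE /pcomp; case: (phi x) => [z|] /=.
    by rewrite mem_imset ?inE //; apply: Some_inj.
  by apply/esym/imsetP=> -[].
have [e1 e1H e12] := lift2 _ e2H; exists e1 => //; rewrite -e23.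
apply/setP=> o; apply/imsetP/imsetP=> [[x xe1 ->]|[y ye2 ->]].
  by have [y ye2 px] := imset_Some_mem e12 xe1; exists y; rewrite // /pcomp px.
by have [x xe1 px] := imset_Some_lift e12 ye2; exists x; rewrite // /pcomp px.
Qed.

Lemma minor_model_bij (H1 H2 : hypergraph) (f : hvertex H1 -> hvertex H2) :
    bijective f ->
    (forall e : {set hvertex H1}, (f @: e \in hedges H2) = (e \in hedges H1)) ->
  minor_model (fun x => Some (f x)).
Proof.
move=> [g fK gK] fH; split=> [y|e eH].
  suff -> : fiber (fun x => Some (f x)) y = [set g y] by apply: connected1.
  by apply/setP=> x; rewrite !inE (inj_eq (@Some_inj _)) (can2_eq fK gK).
have fge : f @: (g @: e) = e.
  by rewrite -imset_comp -[RHS]imset_id; apply: eq_imset.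
by exists (g @: e); rewrite -?fH ?fge // -{2}fge -[RHS]imset_comp.
Qed.

Lemma minor_model_sub (H : hypergraph) (W : {set hvertex H}) (F : {set {set hvertex H}}) :
  @minor_model H (subhypergraph W F) insub.
Proof.
split=> [y|e].
  suff -> : fiber insub y = [set val y] by apply: connected1.
  apply/setP=> x; rewrite !inE; apply/eqP/eqP=> [|->]; last exact: valK.
  by move/(congr1 (omap val)); case: insubP => //= u _ -> [].
rewrite !inE => /andP[_ eH]; exists (val @: e) => //.
by rewrite -imset_comp; apply: eq_imset => u /=; rewrite valK.
Qed.

Lemma contract_map_in (H : hypergraph) (e : {set hvertex H}) x :
  x \in e -> contract_map e x = None.
Proof. by move=> xe; apply: insubN; rewrite negbK. Qed.

Lemma minor_model_contract (H : hypergraph) (e : {set hvertex H}) :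
  e \in hedges H -> @minor_model H (contraction e) (fun x => Some (contract_map e x)).
Proof.
move=> eH; split=> [[u|]|e2].
- suff -> : fiber (fun x => Some (contract_map e x)) (Some u) = [set val u].
    exact: connected1.
  apply/setP=> x; rewrite !inE /contract_map; apply/eqP/eqP=> [[]|->]; last by rewrite valK.
  by case: insubP => // v _ <- [->].
- suff -> : fiber (fun x => Some (contract_map e x)) None = e by apply: connected_hedge.
  apply/setP=> x; rewrite !inE /contract_map (inj_eq (@Some_inj _)).
  by case: insubP => [v /negbTE-> _|/negbNE->].
- move=> /imsetP[f]; rewrite inE => /andP[fH _] ->.
  by exists f => //; rewrite -[RHS]imset_comp.
Qed.

Lemma obtainable_model (H H' : hypergraph) :
  obtainable H H' -> exists phi : hvertex H -> option (hvertex H'), minor_model phi.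
Proof.
elim=> [|H1 W F _ [phi Mphi] _ _|H1 e _ [phi Mphi] eH].
- by exists (fun x => Some (id x)); apply: minor_model_bij => [|e]; [exists id | rewrite imset_id].
- by eexists; apply: (minor_model_comp Mphi); apply: minor_model_sub.
- by eexists; apply: (minor_model_comp Mphi); apply: (minor_model_contract eH).
Qed.

Lemma minor_has_model (H1 H2 : hypergraph) :
  is_minor H2 H1 -> exists phi : hvertex H1 -> option (hvertex H2), minor_model phi.
Proof.
move=> [H /obtainable_model[phi Mphi] [f fbij fH]].
by eexists; apply: (minor_model_comp Mphi); apply: (minor_model_bij fbij fH).
Qed.

(** * From models back to minors *)

Lemma obtainable_trans (H1 H2 H3 : hypergraph) :
  obtainable H1 H2 -> obtainable H2 H3 -> obtainable H1 H3.
Proof. by move=> H12; elim=> // *; [apply: obtainable_sub | apply: obtainable_contract]. Qed.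

Lemma connected_contract (H : hypergraph) (e B : {set hvertex H}) :
  connected B -> @connected (contraction e) (contract_map e @: B).
Proof.
move=> /connectedP[B0 cB]; apply/connectedP; split=> [|A].
  by case/set0Pn: B0 => x xB; apply/set0Pn; exists (contract_map e x); rewrite imset_f.
case/cutsP=> _ [_ [/imsetP[x xB ->] xA /imsetP[y yB ->] yA]].
have [|f [fH fB /cutsP[u [v [uf]]]]] := cB (contract_map e @^-1: A).
  by apply/cutsP; exists x, y; rewrite !inE.
rewrite !inE => uA vf vA; exists (contract_map e @: f); split.
- apply: imset_f; rewrite inE fH; apply/negP=> /subsetP fe; case/negP: vA.
  by rewrite (contract_map_in (fe _ vf)) -(contract_map_in (fe _ uf)).
- exact: imsetS.
- by apply/cutsP; exists (contract_map e u), (contract_map e v); rewrite !imset_f.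
Qed.

(** A hyperedge inside a branch set can be contracted while keeping a model,
    because the images of connected sets stay connected. *)
Lemma model_contract (H1 H2 : hypergraph) (phi : hvertex H1 -> option (hvertex H2))
    (e : {set hvertex H1}) y :
    minor_model phi -> e \in hedges H1 -> e \subset fiber phi y ->
  exists psi : hvertex (contraction e) -> option (hvertex H2), minor_model psi.
Proof.
move=> [con lift_e] eH ey.
(* The map through which phi factors; the new vertex [None] goes to y. *)
pose psi (o : option {x | x \notin e}) := if o is Some u then phi (val u) else Some y.
have psiE x : psi (contract_map e x) = phi x.
  rewrite /contract_map; case: insubP => [u _ <- //|/negbNE /(subsetP ey)].
  by rewrite inE => /eqP.
exists psi; split=> [z|e2 e2H].
  suff -> : fiber (psi : hvertex (contraction e) -> _) z = contract_map e @: fiber phi z.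
    exact: connected_contract.
  apply/setP=> o; rewrite inE; apply/eqP/imsetP=> [|[x + ->]]; last first.
    by rewrite inE psiE => /eqP.
  case: o => [u|] /= pz; first by exists (val u); rewrite ?inE ?pz // /contract_map valK.
  have /set0Pn[x xe] := hedge_neq0 eH; exists x; last by rewrite contract_map_in.
  by have := subsetP ey x xe; rewrite !inE pz.
have [e1 e1H e12] := lift_e _ e2H; exists (contract_map e @: e1); last first.
  by rewrite -imset_comp -e12; apply: eq_imset.
apply: imset_f; rewrite inE e1H; apply/negP=> e1e.
(* A hyperedge inside e would be collapsed to the single vertex y. *)
have : #|e2| <= 1.
  rewrite -(card_imset _ (@Some_inj _)) -e12.
  rewrite -(cards1 (Some y)); apply/subset_leq_card/subsetP=> _ /imsetP[x xe ->].
  by have := subsetP ey x (subsetP e1e x xe); rewrite !inE.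
by rewrite leqNgt hedge_gt1.
Qed.

(** When every branch set is a single vertex, H2 is isomorphic to the
    subhypergraph formed of the domain of phi and of the hyperedges that phi
    maps onto hyperedges of H2. *)
Lemma model_inj_minor (H1 H2 : hypergraph) (phi : hvertex H1 -> option (hvertex H2)) :
    minor_model phi ->
    (forall x x' y, phi x = Some y -> phi x' = Some y -> x = x') ->
  is_minor H2 H1.
Proof.
move=> Mphi inj_phi; have [_ lift_e] := Mphi.
pose W := [set x | phi x].
pose F := [set e in hedges H1 | phi @: e \in [set Some @: e2 | e2 : {set hvertex H2} in hedges H2]].
have FW : forall f, f \in F -> f \subset W.
  move=> f; rewrite inE => /andP[_ /imsetP[e2 _ fe2]]; apply/subsetP=> x xf.
  by have [y _ px] := imset_Some_mem fe2 xf; rewrite inE px.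
have FH : F \subset hedges H1 by apply/subsetP=> f; rewrite inE => /andP[].
exists (subhypergraph W F); first exact: obtainable_sub (obtainable_refl _) FH FW.
have phiW (u : hvertex (subhypergraph W F)) : exists y, phi (val u) == Some y.
  by have := valP u; rewrite inE; case: (phi _) => // y _; exists y.
pose f u := xchoose (phiW u).
have fE u : phi (val u) = Some (f u) by apply/eqP/(xchooseP (phiW u)).
have f_inj : injective f.
  by move=> u v uv; apply/val_inj/(inj_phi _ _ (f u)); rewrite fE ?uv.
have inW y x : phi x = Some y -> x \in W by rewrite inE => ->.
have f_surj y : exists u, f u == y.
  have [x px] := fiber_inhabited Mphi y.
  by exists (Sub x (inW _ _ px)); apply/eqP/Some_inj; rewrite -fE.
exists f.
  exists (fun y => xchoose (f_surj y)) => [u|y]; last exact/eqP/(xchooseP (f_surj y)).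
  by apply: f_inj; apply/eqP/(xchooseP (f_surj (f u))).
move=> e; have phie : phi @: (val @: e) = Some @: (f @: e).
  by rewrite -!imset_comp; apply: eq_imset => u /=; rewrite fE.
rewrite !inE phie mem_imset; last exact/imset_inj/Some_inj.
have [feH|_] := boolP (f @: e \in hedges H2); last by rewrite andbF.
rewrite andbT andbb; have [e1 e1H e1e] := lift_e _ feH.
suff -> : val @: e = e1 by rewrite e1H.
apply/setP=> x; apply/idP/idP=> [xe|xe1].
  have [y yfe px] := imset_Some_mem phie xe.
  by have [x' xe1 px'] := imset_Some_lift e1e yfe; rewrite (inj_phi _ _ _ px px').
have [y yfe px] := imset_Some_mem e1e xe1.
by have [x' xe px'] := imset_Some_lift phie yfe; rewrite (inj_phi _ _ _ px px').
Qed.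

(** A branch set with two vertices contains a hyperedge by connectedness, and
    contracting it decreases the number of vertices. *)
Lemma model_minor (H1 H2 : hypergraph) (phi : hvertex H1 -> option (hvertex H2)) :
  minor_model phi -> is_minor H2 H1.
Proof.
have [n] := ubnP #|hvertex H1|; elim: n H1 phi => // n IHn H1 phi ltn Mphi.
have [/existsP[y /existsP[x /existsP[x' /and3P[/eqP px /eqP px' xx']]]]|] :=
  boolP [exists y, exists x, exists x', [&& phi x == Some y, phi x' == Some y & x != x']].
  have [/(_ y)/connectedP[_ cy] _] := Mphi.
  have [|e [eH ey _]] := cy [set x].
    by apply/cutsP; exists x, x'; rewrite !inE px px' eq_sym.
  have [psi Mpsi] := model_contract Mphi eH ey.
  have [|H obt iso] := IHn _ psi _ Mpsi.
    rewrite -ltnS (leq_trans _ ltn) // !ltnS card_option card_sig.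
    rewrite (eq_card (_ : _ =i ~: e)); last by move=> z; rewrite !inE.
    by rewrite -(cardsC e) -add2n leq_add2r hedge_gt1.
  exists H => //; apply: obtainable_trans obt.
  exact: obtainable_contract (obtainable_refl _) eH.
move=> noex; apply: (model_inj_minor Mphi) => x x' y px px'.
apply/eqP/negPn/negP=> xx'; case/negP: noex.
apply/existsP; exists y; apply/existsP; exists x; apply/existsP; exists x'.
by rewrite px px' xx' eqxx.
Qed.

(** * Colourings of sets of vertices *)

Definition monochrom (T : finType) (K : eqType) (c : T -> K) (e : {set T}) : bool :=
  [forall x in e, forall y in e, c x == c y].

Lemma monochromP (T : finType) (K : eqType) (c : T -> K) (e : {set T}) :
  reflect {in e &, forall x y, c x = c y} (monochrom c e).
Proof.
apply: (iffP forall_inP) => ce x; last by move=> xe; apply/forall_inP=> y ye; apply/eqP/ce.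
by move=> y xe ye; apply/eqP; move/forall_inP: (ce x xe); apply.
Qed.

Lemma monochromPn (T : finType) (K : eqType) (c : T -> K) (e : {set T}) :
  reflect (exists x y, [/\ x \in e, y \in e & c x != c y]) (~~ monochrom c e).
Proof.
rewrite negb_forall_in; apply: (iffP exists_inP) => [[x xe]|[x [y [xe ye cxy]]]].
  by rewrite negb_forall_in => /exists_inP[y ye cxy]; exists x, y.
by exists x => //; rewrite negb_forall_in; apply/exists_inP; exists y.
Qed.

Lemma eq_monochrom (T : finType) (K : eqType) (c d : T -> K) (e : {set T}) :
  {in e, c =1 d} -> monochrom c e = monochrom d e.
Proof.
by move=> cd; apply: eq_forallb_in => x xe; apply: eq_forallb_in => y ye; rewrite !cd.
Qed.

(** Properness of the restriction of c to the hypergraph induced on S. *)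
Definition proper_on (H : hypergraph) (K : eqType) (c : hvertex H -> K)
    (S : {set hvertex H}) : bool :=
  [forall e : {set hvertex H} in hedges H, (e \subset S) ==> ~~ monochrom c e].

Lemma proper_onP (H : hypergraph) (K : eqType) (c : hvertex H -> K) (S : {set hvertex H}) :
  reflect (forall e : {set hvertex H}, e \in hedges H -> e \subset S ->
             exists x y, [/\ x \in e, y \in e & c x != c y])
          (proper_on c S).
Proof.
apply: (iffP forall_inP) => cS e eH; first by move/(implyP (cS e eH))/monochromPn.
by apply/implyP=> /(cS e eH)/monochromPn.
Qed.

Lemma has_coloringP (H : hypergraph) (k : nat) :
  reflect (exists c : hvertex H -> 'I_k, proper_on c setT) (has_coloring H k).
Proof.
apply: (iffP existsP) => [[c /forallP cP]|[c /proper_onP cP]].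
  exists c; apply/proper_onP=> e eH _; apply/monochromPn/negP=> /forall_inP mono.
  have /set0Pn[x xe] := hedge_neq0 eH.
  have /forall_inP/(_ e eH)/subsetP := cP (c x); apply=> y ye.
  by rewrite inE eq_sym (forall_inP (mono x xe)).
exists (finfun c); apply/forallP=> s; apply/forall_inP=> e eH; apply/negP=> /subsetP es.
have [//|x [y [/es + /es]]] := cP e eH.
by rewrite !inE !ffunE => /eqP-> /eqP->; rewrite eqxx.
Qed.

Lemma chromatic_number_le (H : hypergraph) (K : finType) (c : hvertex H -> K) :
  proper_on c setT -> chromatic_number H <= #|K|.
Proof.
move=> /proper_onP cP; rewrite /chromatic_number; case: ex_minnP => m _; apply.
apply/has_coloringP; exists (enum_rank \o c); apply/proper_onP=> e eH eT.
have [x [y [xe ye cxy]]] := cP e eH eT; exists x, y; split=> //=.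
by rewrite (inj_eq enum_rank_inj).
Qed.

Lemma optimal_coloring (H : hypergraph) :
  exists c : hvertex H -> 'I_(chromatic_number H), proper_on c setT.
Proof. by apply/has_coloringP; rewrite /chromatic_number; case: ex_minnP. Qed.

(** * Graphs without a complete minor have bounded chromatic number *)

Section Graphs.
Variables (G : hypergraph) (graphG : is_graph G).
Implicit Types (x y : hvertex G) (A B S T : {set hvertex G}).

Definition adj x y : bool := [set x; y] \in hedges G.

Lemma adj_sym x y : adj x y = adj y x.
Proof. by rewrite /adj setUC. Qed.

Lemma adj_irr x : adj x x = false.
Proof. by apply/negP=> /hedge_gt1; rewrite setUid cards1. Qed.

Lemma graph_properP (K : eqType) (c : hvertex G -> K) S :
  reflect {in S &, forall x y, adj x y -> c x != c y} (proper_on c S).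
Proof.
apply: (iffP (proper_onP _ _)) => cS.
  move=> x y xS yS xy; have [|u [v []]] := cS _ xy.
    by apply/subsetP=> z /set2P[]->.
  by move=> /set2P[]-> /set2P[]->; rewrite ?eqxx // eq_sym.
move=> e eG /subsetP eS; have /forall_inP/(_ e eG)/cards2P[x [y [xy def_e]]] := graphG.
have [xe ye] : x \in e /\ y \in e by rewrite def_e set21 set22.
by exists x, y; split=> //; apply: cS; rewrite ?eS // /adj -def_e.
Qed.

Definition attached B T : Prop := {in T, forall y, exists2 x, x \in B & adj x y}.

Lemma connected_attached B T : connected B -> attached B T -> connected (B :|: T).
Proof.
move=> cB att; apply: (connected_absorb cB (subsetUl _ _)) => y.
rewrite !inE => /andP[/negbTE->] /= yT; have [x xB xy] := att y yT.
exists [set x; y]; split; rewrite ?set22 //.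
  by apply/subsetP=> z /set2P[]->; rewrite inE ?xB ?yT ?orbT.
by apply/set0Pn; exists x; rewrite !inE eqxx.
Qed.

(** Breadth-first search without distances.  The coloured region A grows by
    one layer L at a time.  The set B is the explored part of the current
    component (empty at the start); every vertex of the next layer has a
    neighbour in B, so the hypothesis provides a colouring of that layer.  The
    vertices of A with a neighbour outside A lie in the last layer and all use
    the palette p, so the next layer may use the other palette. *)
Lemma layered_coloring (K : finType) (k0 : K) S :
    (forall B T, connected B -> B \subset S -> T \subset S -> [disjoint B & T] ->
       attached B T -> exists c : hvertex G -> K, proper_on c T) ->
  exists c : hvertex G -> bool * K, proper_on c S.
Proof.
move=> colT; pose next A := [set y in S :\: A | [exists x in A, adj x y]].
suff grow n A B p (c : hvertex G -> bool * K) :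
    #|S :\: A| < n -> A \subset S -> B \subset A -> proper_on c A ->
    (next A != set0 -> connected B) -> attached B (next A) ->
    (forall x y, x \in A -> y \in next A -> adj x y -> (c x).1 = p) ->
  exists c : hvertex G -> bool * K, proper_on c S.
  have next0 : next set0 = set0.
    by apply/setP=> y; rewrite !inE; apply/andP=> -[_ /exists_inP[x]]; rewrite inE.
  apply: (grow #|S|.+1 set0 set0 true (fun _ => (true, k0))); rewrite ?sub0set ?setD0 //.
  - by apply/graph_properP=> x y; rewrite inE.
  - by rewrite next0 eqxx.
  - by rewrite next0; move=> y; rewrite in_set0.
elim: n A B p c => // n IHn A B p c ltn AS BA /graph_properP cA conB att frontier.
have [SA0|[v]] := set_0Vmem (S :\: A).
  exists c; have -> : S = A by apply/eqP; rewrite eqEsubset AS -setD_eq0 SA0 eqxx.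
  exact/graph_properP.
rewrite inE => /andP[vA vS].
(* The new layer is the neighbourhood of A or, when that is empty, an arbitrary
   vertex v, from which the exploration of a new component starts. *)
have [L [B' [d [[L0 LS disjLA] nextL [conB' B'sub LB'] /graph_properP dL]]]] :
    exists L B' (d : hvertex G -> K),
    [/\ [/\ L != set0, L \subset S & [disjoint L & A]], next A \subset L,
        [/\ connected B', B' \subset A :|: L & L \subset B'] & proper_on d L].
  have [nextA0|nextA] := eqVneq (next A) set0.
    exists [set v], [set v], (fun _ => k0); rewrite nextA0 sub0set sub1set subsetUr subxx.
    rewrite vS connected1 disjoints1 vA -card_gt0 cards1; split=> //.
    by apply/graph_properP=> x y /set1P-> /set1P->; rewrite adj_irr.
  have nextS : next A \subset S by apply/subsetP=> y; rewrite !inE => /andP[/andP[]].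
  have disjA : [disjoint next A & A].
    by rewrite disjoint_subset; apply/subsetP=> y; rewrite !inE => /andP[/andP[]].
  have BS := subset_trans BA AS.
  have disjB : [disjoint B & next A].
    by rewrite disjoint_sym; apply: disjointWr disjA.
  have [d dP] := colT B (next A) (conB nextA) BS nextS disjB att.
  exists (next A), (B :|: next A), d; rewrite subxx subsetUr setSU //; split=> //.
  by split=> //; apply: connected_attached att; apply: conB.
have LA x : x \in L -> x \in A = false by move/(disjointFr disjLA).
have inL x y : x \in A -> y \in S -> y \notin A -> adj x y -> y \in L.
  move=> xA yS yA xy; apply: (subsetP nextL); rewrite !inE yA yS.
  by apply/exists_inP; exists x.
have next' x y : x \in A :|: L -> y \in next (A :|: L) -> adj x y -> x \in L.
  rewrite !inE negb_or => /orP[xA|//] /andP[/andP[/andP[yA yL] yS] _] xy.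
  by case/negP: yL; apply: inL xy.
have frontierL x y : x \in A -> y \in L -> adj x y -> (c x).1 = p.
  move=> xA yL xy; apply: (frontier x y) => //; rewrite !inE LA // (subsetP LS) //=.
  by apply/exists_inP; exists x.
pose c' x := if x \in A then c x else (~~ p, d x).
apply: (IHn (A :|: L) B' (~~ p) c') => //.
- have /set0Pn[x xL] := L0; apply: leq_trans (ltn : #|_| <= n).
  apply/proper_card/properP; split; first by rewrite setDS ?subsetUl.
  by exists x; rewrite !inE ?LA ?xL // (subsetP LS).
- by rewrite subUset AS.
- apply/graph_properP=> x y; rewrite /c' !inE.
  case xA: (x \in A); case yA: (y \in A) => //= xL yL xy.
  + exact: cA.
  + by apply/eqP=> /(congr1 fst); rewrite (frontierL _ _ xA yL xy); case: (p).
  + rewrite adj_sym in xy.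
    by apply/eqP=> /(congr1 fst); rewrite (frontierL _ _ yA xL xy); case: (p).
  + by rewrite xpair_eqE eqxx; apply: dL.
- move=> y nexty; have: y \in next (A :|: L) by [].
  rewrite inE => /andP[_ /exists_inP[x xAL xy]].
  by exists x => //; apply: (subsetP LB'); apply: next' xy.
- by move=> x y xAL yn xy; rewrite /c' LA //; apply: next' xy.
Qed.

End Graphs.

(** The new branch set B is adjacent to every vertex used by the model of K_t,
    hence to each of its branch sets. *)
Lemma clique_model_extend (G : hypergraph) (t : nat) (B : {set hvertex G})
    (phi : hvertex G -> option 'I_t) :
    @minor_model G (complete_graph t) phi -> connected B ->
    (forall x, phi x -> x \notin B) -> attached B [set x | phi x] ->
  @minor_model G (complete_graph t.+1)
    (fun x => if x \in B then Some ord0 else omap (lift ord0) (phi x)).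
Proof.
move=> Mphi conB phiB att; have [con lift_e] := Mphi.
set psi := fun x => _.
have psiB x : x \in B -> psi x = Some ord0 by rewrite /psi => ->.
have psiS x i : phi x = Some i -> psi x = Some (lift ord0 i).
  by move=> px; rewrite /psi (negbTE (phiB x _)) px.
have edge0 j : exists2 e1, e1 \in hedges G & psi @: e1 = [set Some ord0; Some (lift ord0 j)].
  have [y py] := fiber_inhabited Mphi j.
  have [|x xB xy] := att y; first by rewrite inE py.
  by exists [set x; y]; rewrite // imsetU1 imset_set1 (psiB _ xB) (psiS _ _ py).
split=> [i|e2].
  case: (unliftP ord0 i) => [j|] ->.
    rewrite (_ : fiber _ _ = fiber phi j); first exact: con.
    apply/setP=> x; rewrite !inE; apply/eqP/eqP=> [|/psiS//].
    by rewrite /psi; case: ifP => // _; case: (phi x) => //= k /Some_inj/lift_inj->.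
  rewrite (_ : fiber _ _ = B) //; apply/setP=> x; rewrite !inE.
  apply/eqP/idP=> [|/psiB//].
  by rewrite /psi; case: ifP => // _; case: (phi x).
rewrite inE => /cards2P[i [j [ij ->]]]; rewrite imsetU1 imset_set1.
case: (unliftP ord0 i) ij => [i'|] ->; case: (unliftP ord0 j) => [j'|] -> ij //.
- have ij' : i' != j' by apply: contraNneq ij => ->.
  have [|e1 e1G e12] := lift_e [set i'; j']; first by rewrite inE cards2 ij'.
  exists e1 => //; move: e12; rewrite imsetU1 imset_set1 => e12.
  have -> : psi @: e1 = omap (lift ord0) @: (phi @: e1).
    rewrite -imset_comp; apply: eq_in_imset => x xe /=.
    have [k _ pk] : exists2 k, k \in [set i'; j'] & phi x = Some k.
      by apply: imset_Some_mem xe; rewrite imsetU1 imset_set1.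
    by rewrite (psiS _ _ pk) pk.
  by rewrite e12 imsetU1 imset_set1.
- by rewrite setUC; apply: edge0.
Qed.

(** A set of 2^t colours, in the form produced by [layered_coloring]. *)
Fixpoint palette (t : nat) : finType :=
  if t is t'.+1 then (bool * palette t')%type : finType else unit.

Lemma palette_inhabited t : palette t.
Proof. by elim: t => [|t c]; [exact: tt | exact: (true, c)]. Qed.

(** If a set T attached to a connected set B contained a model of K_(t+1), then
    B would extend it to K_(t+2); so all such T have few colours, and
    [layered_coloring] doubles their number. *)
Lemma clique_model_or_coloring (G : hypergraph) (t : nat) (S : {set hvertex G}) :
    is_graph G ->
  (exists phi : hvertex G -> option 'I_t.+1,
     @minor_model G (complete_graph t.+1) phi /\ forall x, phi x -> x \in S) \/
  (exists c : hvertex G -> palette t, proper_on c S).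
Proof.
move=> graphG; elim: t S => [|t IHt] S.
  have [->|/set0Pn[v vS]] := eqVneq S set0.
    by right; exists (fun _ => tt); apply/graph_properP=> // x y; rewrite inE.
  left; exists (fun x => if x == v then Some ord0 else None); split; last first.
    by move=> x; case: eqP => // ->.
  split=> [y|e]; last first.
    by rewrite inE => /eqP card_e; have := max_card (mem e); rewrite card_e card_ord.
  have -> : fiber (fun x => if x == v then Some ord0 else None) y = [set v].
    by apply/setP=> x; rewrite !inE [y]ord1; case: (x == v).
  exact: connected1.
have [|noM] := Classical_Prop.classic (exists phi : hvertex G -> option 'I_t.+2,
    @minor_model G (complete_graph t.+2) phi /\ forall x, phi x -> x \in S); [by left|].
right; apply: (layered_coloring graphG (palette_inhabited t)) => B T conB BS TS disjBT att.
have [[phi [Mphi phiT]]|//] := IHt T; case: noM; eexists; split.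
  apply: (clique_model_extend Mphi conB) => [x /phiT xT|y].
    by apply/negP=> xB; rewrite (disjointFr disjBT xB) in xT.
  by rewrite inE => /phiT; apply: att.
move=> x /=; case: ifP => [xB _|_]; first exact: (subsetP BS).
by case px: (phi x) => // _; apply/(subsetP TS)/phiT; rewrite px.
Qed.

Lemma graph_chromatic_bound (t : nat) (G : hypergraph) :
    is_graph G -> ~ is_minor (complete_graph t.+1) G ->
  chromatic_number G <= #|palette t|.
Proof.
move=> graphG noK; have [[phi [Mphi _]]|[c]] := clique_model_or_coloring t setT graphG.
  by case: noK; apply: model_minor Mphi.
exact: chromatic_number_le.
Qed.

(** * The greedy decomposition of a hypergraph *)

Section Quotient.
Variables (H : hypergraph) (Q : finType) (q : hvertex H -> Q).

Definition quotient_edges : {set {set Q}} :=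
  [set q @: f | f : {set hvertex H} in hedges H & #|q @: f| == 2].

Lemma quotient_edges_card2 : [forall e : {set Q} in quotient_edges, #|e| == 2].
Proof. by apply/forall_inP=> _ /imsetP[f + ->]; rewrite inE => /andP[]. Qed.

Lemma quotient_edges_ge2 : [forall e : {set Q} in quotient_edges, 2 <= #|e|].
Proof. by apply/forall_inP=> e /(forall_inP quotient_edges_card2)/eqP->. Qed.

Definition quotient_graph : hypergraph := Hypergraph quotient_edges_ge2.

Lemma minor_model_quotient :
    (forall y, connected [set x | q x == y]) ->
  @minor_model H quotient_graph (fun x => Some (q x)).
Proof.
move=> conq; split=> [y|_ /imsetP[f + ->]]; first exact: conq.
by rewrite inE => /andP[fH _]; exists f; rewrite // -[RHS]imset_comp.
Qed.

End Quotient.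

Section Parts.
Variable H : hypergraph.
Implicit Types (x y z : hvertex H) (e f U X Y : {set hvertex H}).

Definition minimal_hedge e : bool := minset (fun f => f \in hedges H) e.

(** Induction on the number of vertices of e outside X.  If there are two of
    them, y and z, colour X properly and give z a colour different from that of
    the other vertices of e outside X.  By maximality of X this is not a proper
    2-colouring of X union e, so some minimal hyperedge g is monochromatic.  It
    is not contained in X, where the colouring is proper; it meets X, as
    otherwise it would be a proper subset of e; and it misses y or z. *)
Lemma attaching_hedge U X e :
    connected X -> (exists c : hvertex H -> bool, proper_on c X) ->
    (forall Y (c : hvertex H -> bool),
       X \proper Y -> Y \subset U -> connected Y -> ~~ proper_on c Y) ->
    X \subset U -> minimal_hedge e -> e \subset U -> e :&: X != set0 -> ~~ (e \subset X) ->
  exists f z, [/\ f \in hedges H, z \in e, z \notin X &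
                  [/\ z \in f, f \subset z |: X & f :&: X != set0]].
Proof.
move=> conX [c /proper_onP cX] maxX XU.
have [n] := ubnP #|e :\: X|; elim: n e => // n IHn e ltn mine eU eX /subsetPn[z ze zX].
have [eH min_e] := minsetP mine.
have [eXz|] := boolP (e :\: X \subset [set z]).
  exists e, z; split=> //; split=> //; apply/subsetP=> x xe; rewrite !inE.
  have [//|xX] := boolP (x \in X); first by rewrite orbT.
  by have := subsetP eXz x; rewrite !inE xX => ->.
case/subsetPn=> y; rewrite !inE => /andP[yX ye] yz.
pose c' x := if x \in X then c x else x == z.
have XXe : X \proper X :|: e.
  by apply/properP; split; [apply: subsetUl | exists z; rewrite // inE ze orbT].
have conXe : connected (X :|: e).
  apply: (connected_absorb conX (subsetUl _ _)) => x; rewrite !inE => /andP[/negbTE->] xe.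
  by exists e; split; rewrite ?subsetUr.
have XeU : X :|: e \subset U by rewrite subUset XU.
have := maxX _ c' XXe XeU conXe.
rewrite negb_forall_in => /exists_inP[f fH]; rewrite negb_imply negbK => /andP[fXe monof].
have [g ming gf] := minset_exists (fH : (fun f => f \in hedges H) f).
have [gH min_g] := minsetP ming.
have monog u v : u \in g -> v \in g -> c' u = c' v.
  by move=> ug vg; apply: (monochromP _ _ monof); apply: (subsetP gf).
have gXe : g \subset X :|: e := subset_trans gf fXe.
have gX : ~~ (g \subset X).
  apply/negP=> gX; have [u [v [ug vg]]] := cX g gH gX.
  by have := monog u v ug vg; rewrite /c' !(subsetP gX) // => ->; rewrite eqxx.
have gXn0 : g :&: X != set0.
  apply/negP=> gX0; have ge : g \subset e.
    apply/subsetP=> u ug; have := subsetP gXe u ug; rewrite inE => /orP[uX|//].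
    by have := in_set0 u; rewrite -(eqP gX0) inE ug uX.
  by case/negP: eX; rewrite -(min_e g gH ge).
have sub_gX : g :\: X \subset e :\: X.
  apply/subsetP=> u; rewrite !inE => /andP[uX ug]; have := subsetP gXe u ug.
  by rewrite inE (negbTE uX).
have [||f0 [w [f0H wg wX f0P]]] := IHn g _ ming _ gXn0 gX.
- rewrite -ltnS; apply: leq_trans ltn; rewrite ltnS; apply: proper_card.
  apply/properP; split=> //; have [zg|zg] := boolP (z \in g).
    exists y; rewrite !inE yX //=; apply: contra yz => yg.
    by have := monog y z yg zg; rewrite /c' (negbTE yX) (negbTE zX) eqxx.
  by exists z; rewrite !inE zX.
- exact: subset_trans gXe XeU.
by exists f0, w; split=> //; have := subsetP sub_gX w; rewrite !inE wX => /(_ wg).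
Qed.

Lemma part_exists U v : v \in U ->
  exists X (c : hvertex H -> bool),
    [/\ connected X, proper_on c X, X \subset U &
      forall Y (c' : hvertex H -> bool),
        X \proper Y -> Y \subset U -> connected Y -> ~~ proper_on c' Y].
Proof.
move=> vU.
pose P X := [&& connected X, X \subset U & [exists c : {ffun hvertex H -> bool}, proper_on c X]].
have [|X /maxsetP[/and3P[conX XU /existsP[c cX]] maxX] _] := @maxset_exists _ P [set v].
  rewrite /P connected1 sub1set vU; apply/existsP; exists [ffun=> true].
  apply/proper_onP=> e /hedge_gt1 e_gt1 /subset_leq_card.
  by rewrite cards1 leqNgt e_gt1.
exists X, c; split=> // Y c' XY YU conY; apply/negP=> /proper_onP cY.
have XYs := proper_sub XY; move: XY; rewrite -(maxX Y) ?properxx //.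
rewrite /P conY YU; apply/existsP; exists (finfun c'); apply/proper_onP=> e eH eY.
by have [x [y]] := cY e eH eY; exists x, y; rewrite !ffunE.
Qed.

(** The map r sends a vertex to a representative of its part, so that parts are
    the fibres of r and r x = r y means that x and y lie in the same part; c
    gathers the 2-colourings of the parts.  The last clause says that a minimal
    hyperedge e meeting two parts meets two parts that are adjacent in the
    quotient graph. *)
Lemma greedy_parts U :
  exists (r : hvertex H -> hvertex H) (c : hvertex H -> bool),
  [/\ {in U, forall x, r x \in U},
      {in U, forall x, connected [set y in U | r y == r x]},
      forall e, e \in hedges H -> e \subset U -> monochrom r e -> ~~ monochrom c e &
      forall e, minimal_hedge e -> e \subset U -> ~~ monochrom r e ->
        exists f x y, [/\ f \in hedges H, f \subset U, x \in e, y \in e &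
                          r x != r y /\ r @: f = [set r x; r y]]].
Proof.
have [n] := ubnP #|U|; elim: n U => // n IHn U ltn.
have [->|/set0Pn[v vU]] := eqVneq U set0.
  exists id, (fun _ => true); split=> [x|x|e /hedge_neq0 e0|e /minsetP[/hedge_neq0 e0 _]];
    by rewrite ?in_set0 ?subset0 ?(negbTE e0).
have [X [c [conX cX XU maxX]]] := part_exists vU.
have /connectedP[/set0Pn[x0 x0X] _] := conX.
have [|r' [c' [r'U conr' r'c' r'e]]] := IHn (U :\: X).
  rewrite -ltnS; apply: leq_trans ltn; rewrite ltnS; apply: proper_card.
  apply/properP; split; first exact: subsetDl.
  by exists x0; rewrite ?(subsetP XU) // !inE x0X.
pose r x := if x \in X then x0 else r' x.
pose d x := if x \in X then c x else c' x.
have rX x : x \in X -> r x = x0 by rewrite /r => ->.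
have rN x : x \notin X -> r x = r' x by rewrite /r => /negbTE->.
have r_x0 x : x \in U -> (r x == x0) = (x \in X).
  move=> xU; have [xX|xX] := boolP (x \in X); first by rewrite rX ?eqxx.
  have := r'U x; rewrite rN // !inE xX xU => /(_ isT).
  by apply: contraTF => /eqP->; rewrite x0X.
have outside e : e \subset U -> e :&: X = set0 ->
    [/\ e \subset U :\: X, {in e, r =1 r'} & {in e, d =1 c'}].
  move=> eU eX0; have eX x : x \in e -> x \notin X.
    by move=> xe; apply/negP=> xX; have := in_set0 x; rewrite -eX0 inE xe xX.
  split=> [|x /eX/rN//|x /eX/negbTE xX]; last by rewrite /d xX.
  by apply/subsetP=> x xe; rewrite inE eX ?(subsetP eU).
exists r, d; split.
- move=> x xU; have [xX|xX] := boolP (x \in X); first by rewrite rX // (subsetP XU).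
  by have := r'U x; rewrite rN // !inE xX xU => /(_ isT)/andP[].
- move=> x xU; have [xX|xX] := boolP (x \in X).
    rewrite (_ : [set y in U | _] = X) //; apply/setP=> y; rewrite inE (rX x) //.
    have [yU|yU] := boolP (y \in U); first exact: r_x0.
    by apply/esym; apply: contraNF yU => /(subsetP XU).
  rewrite (_ : [set y in U | _] = [set y in U :\: X | r' y == r' x]).
    by apply: conr'; rewrite inE xX.
  apply/setP=> y; rewrite !inE (rN x) //; have [yX|yX] := boolP (y \in X); last by rewrite rN.
  rewrite rX // eq_sym -(rN x) // r_x0 // (negbTE xX) andbF //.
- move=> e eH eU mono; have [eX0|/set0Pn[x /setIP[xe xX]]] := eqVneq (e :&: X) set0.
    have [eUX rr' dc'] := outside e eU eX0.
    have /r'c'/(_ eUX) := eH; rewrite -(eq_monochrom dc') -(eq_monochrom rr'); exact.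
  have eX : e \subset X.
    apply/subsetP=> y ye; rewrite -r_x0 ?(subsetP eU) // -(rX x) //.
    by apply/eqP; apply: (monochromP _ _ mono).
  have dc : {in e, d =1 c} by move=> y /(subsetP eX) yX; rewrite /d yX.
  by rewrite (eq_monochrom dc); apply/monochromPn; apply: (proper_onP _ _ cX).
move=> e mine eU bi; have [eX0|eX] := eqVneq (e :&: X) set0.
  have [eUX rr' _] := outside e eU eX0.
  have [|f [x [y [fH fUX xe ye [rxy fr]]]]] := r'e e mine eUX.
    by rewrite -(eq_monochrom rr').
  exists f, x, y; rewrite !rr' //; split=> //; first exact: subset_trans fUX (subsetDl _ _).
  split=> //; rewrite -fr; apply: eq_in_imset => z /(subsetP fUX).
  by rewrite inE => /andP[/rN].
have neX : ~~ (e \subset X).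
  apply: contra bi => /subsetP eX'; apply/monochromP=> x y /eX' xX /eX' yX.
  by rewrite !rX.
have [f [z [fH ze zX [zf fzX fX]]]] :=
  attaching_hedge conX (ex_intro _ c cX) maxX XU mine eU eX neX.
have /set0Pn[x /setIP[xe xX]] := eX; have zU := subsetP eU z ze.
exists f, x, z; split=> //.
  by apply: subset_trans fzX _; rewrite subUset sub1set zU.
have rz : r z != x0 by rewrite r_x0.
rewrite (rX x) // eq_sym; split=> //; apply/setP=> y; apply/imsetP/set2P=> [[u uf ->]|].
  by have := subsetP fzX u uf; rewrite !inE => /orP[/eqP->|/rX]; [right|left].
have /set0Pn[u /setIP[uf uX]] := fX.
by case=> ->; [exists u; rewrite // rX | exists z].
Qed.

End Parts.

(** A proper colouring d of the quotient graph and the 2-colouring c of its parts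
    combine to x |-> (c x, d (q x)).  On a minimal hyperedge inside a part the
    first component varies; on any other one the second does. *)
Lemma chromatic_number_quotient (H : hypergraph) :
  exists G : hypergraph,
    [/\ is_graph G, exists phi : hvertex H -> option (hvertex G), minor_model phi &
        chromatic_number H <= 2 * chromatic_number G].
Proof.
have [r [c [_ conr rc re]]] := greedy_parts [set: hvertex H].
pose Q : finType := {y | y \in r @: setT}.
pose q x : Q := Sub (r x) (imset_f r (in_setT x)).
have qE x y : (q x == q y) = (r x == r y) by rewrite -val_eqE.
exists (quotient_graph q); split; first exact: quotient_edges_card2.
  exists (fun x => Some (q x)); apply: minor_model_quotient => y.
  have /imsetP[x _ ryx] := valP y.
  rewrite (_ : [set _ | _] = [set z in setT | r z == r x]); first exact: conr.
  by apply/setP=> z; rewrite !inE -val_eqE /= ryx.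
have [d /proper_onP dP] := optimal_coloring (quotient_graph q).
rewrite -[2]card_bool -[X in _ * X]card_ord -card_prod.
apply: (chromatic_number_le (c := fun x => (c x, d (q x)))).
apply/proper_onP=> e eH _; apply/monochromPn/negP=> /monochromP mono.
have [e0 mine0 /subsetP e0e] := minset_exists (eH : (fun f => f \in hedges H) e).
have [e0H _] := minsetP mine0.
have [mono_r|] := boolP (monochrom r e0).
  case/negP: (rc e0 e0H (subsetT _) mono_r).
  by apply/monochromP=> x y xe ye; have [] := mono x y (e0e x xe) (e0e y ye).
case/(re e0 mine0 (subsetT _)) => f [x [y [fH _ xe ye [rxy fr]]]].
have fq : q @: f = [set q x; q y].
  by apply: (imset_inj val_inj); rewrite -imset_comp imsetU1 imset_set1 -[RHS]fr.
have [||u [v []]] := dP (q @: f); rewrite ?subsetT //.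
  by apply: imset_f; rewrite inE fH fq cards2 qE rxy.
have dxy : d (q x) = d (q y) by have [] := mono x y (e0e x xe) (e0e y ye).
by rewrite fq => /set2P[]-> /set2P[]->; rewrite ?dxy eqxx.
Qed.

(** * Extremal chromatic numbers *)

Lemma max_chromatic_number_ex (P : hypergraph -> Prop) (N : nat) :
    (exists H, P H) -> (forall H, P H -> chromatic_number H <= N) ->
  exists m, max_chromatic_number P m.
Proof.
move=> exP; elim: N => [|N IHN] leN.
  exists 0; split=> //; have [H PH] := exP; exists H => //.
  by apply/eqP; rewrite -leqn0 leN.
have [[H PH HN]|noH] := Classical_Prop.classic (exists2 H, P H & chromatic_number H = N.+1).
  by exists N.+1; split=> //; exists H.
apply: IHN => H PH; have := leN H PH; rewrite leq_eqVlt ltnS => /orP[/eqP HN|//].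
by case: noH; exists H.
Qed.

Lemma no_hedges_ge2 : [forall e : {set void} in set0, 2 <= #|e|].
Proof. by apply/forall_inP=> e; rewrite inE. Qed.

(** A witness that both maxima, g(t) and h(t), are taken over a nonempty class. *)
Definition empty_hypergraph : hypergraph := Hypergraph no_hedges_ge2.

Lemma empty_graph_minor_free (t : nat) :
  is_graph empty_hypergraph /\ ~ is_minor (complete_graph t.+1) empty_hypergraph.
Proof.
split; first by apply/forall_inP=> e; rewrite inE.
by case/minor_has_model=> phi /fiber_inhabited/(_ ord0)[[]].
Qed.

Theorem theorem1 (t : nat) (t_ge2 : 2 <= t) :
  exists g h : nat,
    [/\ is_g t g,
        is_h t h,
        forall H : hypergraph,
          ~ is_minor (complete_graph t) H -> colorable (2 * g) H
      & h <= 2 * g].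
Proof.
case: t t_ge2 => // t _; have [graph0 free0] := empty_graph_minor_free t.
have [||g gP] := @max_chromatic_number_ex
  (fun G => is_graph G /\ ~ is_minor (complete_graph t.+1) G) #|palette t|.
- by exists empty_hypergraph.
- by move=> G [graphG freeG]; apply: graph_chromatic_bound.
have hyper_bound (H : hypergraph) :
    ~ is_minor (complete_graph t.+1) H -> chromatic_number H <= 2 * g.
  move=> freeH; have [G [graphG [phi Mphi] chiH]] := chromatic_number_quotient H.
  apply: leq_trans chiH _; rewrite leq_mul2l; case: gP => _; apply; split=> //.
  case/minor_has_model=> psi Mpsi; apply: freeH.
  exact: model_minor (minor_model_comp Mphi Mpsi).
have [|h hP] := @max_chromatic_number_ex
  (fun H => ~ is_minor (complete_graph t.+1) H) (2 * g) _ hyper_bound.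
  by exists empty_hypergraph.
exists g, h; split=> //.
by case: hP => -[H freeH <-] _; apply: hyper_bound.
Qed.
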